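(* Let $E$ be a real or complex vector space of countably infinite dimension with a fixed Hamel basis $(e_n)_{n=1}^\infty$, and let $\sigma$ be a large subset of $\Sigma_\infty(E)$. Suppose: (a) there is a sequence of absolutely convex sets $C_n\subset E$ such that $C_n\cap F$ is compact for every finite-dimensional subspace $F$ of $E$ and every $n$, and $\sigma\subset\prod_{n=1}^\infty C_n$; (b) $\sigma$ is analytic as a subset of $(\Sigma_\infty(E),\mathcal T_p)$. Let $(\rho_n)_{n=1}^\infty$ be any sequence of F-norms on $E$ and define, for $u=(u_1,u_2,\ldots)$, $v=(v_1,v_2,\ldots)\in\Sigma_\infty(E)$, $$d(u,v)=\sum_{j=1}^\infty\rho_j(u_j-v_j)\in[0,\infty].$$ For $\epsilon>0$ let $\sigma_\epsilon=\{u\in\Sigma_\infty(E):\ \inf_{v\in\sigma}d(u,v)<\epsilon\}$. Then for every $\epsilon>0$ there is a block subspace $V\in\mathcal B(E)$ such that $\sigma_\epsilon$ is strategically large for $V$.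
   Context: $\mathcal T$ is the finest vector topology on $E$: $U\subset E$ is $\mathcal T$-open iff $U\cap F$ is open in $F$ for every finite-dimensional subspace $F$. $\mathcal T_p$ is the product topology on $E^{\mathbb N}$ induced by $\mathcal T$. Block bases: a finite or infinite sequence $(v_k)$ of nonzero vectors of $E$ is a block basis of $(e_n)$ if there are integers $0=p_0<p_1<p_2<\cdots$ with $v_k\in\mathrm{span}\{e_{p_{k-1}+1},\ldots,e_{p_k}\}$ for each $k$. $\Sigma_\infty(E)\subset E^{\mathbb N}$ is the set of infinite block bases, $\Sigma_n(E)$ the set of block bases of length $n$, $\Sigma_0(E)=\{\emptyset\}$, and $\Sigma_{<\infty}(E)=\bigcup_{0\le n<\infty}\Sigma_n(E)$. For $A\subset E$, $\Sigma_\infty(A)$ is the set of infinite block bases with all entries in $A$. $\mathcal B(E)$ is the collection of infinite-dimensional block subspaces, i.e. linear spans of infinite block bases. $(\Sigma_\infty(E),\mathcal T_p)$ is a Polish space; a subset is analytic if it is a continuous image of $\mathbb N^{\mathbb N}$. $\sigma\subset\Sigma_\infty(E)$ is large if $\sigma\cap\Sigma_\infty(V)\ne\emptyset$ for every $V\in\mathcal B(E)$. A strategy is a map $\Phi:\Sigma_{<\infty}(E)\times\mathcal B(E)\to\Sigma_{<\infty}(E)$ such that for every $(u_1,\ldots,u_n)\in\Sigma_n(E)$ and $V\in\mathcal B(E)$, $\Phi(u_1,\ldots,u_n;V)=(u_1,\ldots,u_n,u_{n+1})$ for some $u_{n+1}\in V$. Given a sequence $V_1,V_2,\ldots\in\mathcal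 B(E)$, $\Phi(V_1,V_2,\ldots)$ denotes the infinite sequence $(u_1,u_2,\ldots)$ obtained by iteration from $\emptyset$: $(u_1,\ldots,u_k)=\Phi(u_1,\ldots,u_{k-1};V_k)$ for all $k\ge1$. $\tau\subset\Sigma_\infty(E)$ is strategically large for $V\in\mathcal B(E)$ if there is a strategy $\Phi$ such that $\Phi(V_1,V_2,\ldots)\in\tau$ for every sequence $(V_j)_{j=1}^\infty$ in $\mathcal B(E)$ with $V_j\subset V$ for all $j$. An F-norm on $E$ is a function $\rho:E\to[0,\infty)$ with $\rho(x)=0$ iff $x=0$, $\rho(x+y)\le\rho(x)+\rho(y)$, $\rho(\lambda x)\le\rho(x)$ for $|\lambda|\le1$, and $\rho(\lambda x)\to0$ as $\lambda\to0$ for each fixed $x$. *)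

(* Defs.v *)
From HB Require Import structures.
From mathcomp Require Import all_boot all_order all_algebra complex.
From mathcomp Require Import all_classical all_reals all_analysis.
Import Order.TTheory GRing.Theory Num.Theory.
Import numFieldTopology.Exports numFieldNormedType.Exports.

Set Implicit Arguments.
Unset Strict Implicit.
Unset Printing Implicit Defensive.

Local Open Scope classical_set_scope.
Local Open Scope ring_scope.

Variant scalar_kind := RealScalars | ComplexScalars.

Definition scalar_field (R : realType) (k : scalar_kind) : numFieldType :=
  match k with
  | RealScalars => R
  | ComplexScalars => R[i]%C
  end.

Section LinearAlgebra.
Variables (K : numFieldType) (E : lmodType K).
Implicit Types (A C : set E).

Definition lin_span A : set E :=
  [set x | exists (n : nat) (a : 'I_n -> K) (b : 'I_n -> E),
     (forall i, A (b i)) /\ x = \sum_(i < n) a i *: b i].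

Definition lin_indep (n : nat) (b : 'I_n -> E) : Prop :=
  forall a : 'I_n -> K, \sum_(i < n) a i *: b i = 0 -> forall i, a i = 0.

Definition hamel_basis (e : nat -> E) : Prop :=
  (forall n, lin_indep (fun i : 'I_n => e i)) /\ lin_span (range e) = setT.

Definition findim_subspace (F : set E) : Prop :=
  exists (n : nat) (b : 'I_n -> E), F = lin_span (range b).

Definition absolutely_convex C : Prop :=
  forall (x y : E) (a b : K), C x -> C y -> `|a| + `|b| <= 1 ->
    C (a *: x + b *: y).

(* A finite-dimensional subspace F with basis b carries the topology of K^n
   transported along the coordinate isomorphism, so [open (U `&` F) in F] is
   openness of the set of coordinate vectors of U `&` F. *)
Definition finest_open (U : set E) : Prop :=
  forall (n : nat) (b : 'I_n -> E), lin_indep b ->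
    open [set a : 'rV[K]_n | U (\sum_(i < n) a 0 i *: b i)].

Lemma finest_openT : finest_open setT.
Proof. by move=> n b _; exact: openT. Qed.

Lemma finest_openI : setI_closed finest_open.
Proof. by move=> U V oU oV n b bi; exact: openI (oU n b bi) (oV n b bi). Qed.

Lemma finest_open_bigU (I : Type) (f : I -> set E) :
  (forall i, finest_open (f i)) -> finest_open (\bigcup_i f i).
Proof.
by move=> of_ n b bi; apply: (@bigcup_open _ I setT) => i _; exact: of_ bi.
Qed.

End LinearAlgebra.

(* E endowed with its finest vector topology. *)
Definition finest (K : numFieldType) (E : lmodType K) : Type := E.

HB.instance Definition _ (K : numFieldType) (E : lmodType K) :=
  GRing.Lmodule.on (finest E).
HB.instance Definition _ (K : numFieldType) (E : lmodType K) :=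
  isOpenTopological.Build (finest E)
    (@finest_openT K E) (@finest_openI K E) (@finest_open_bigU K E).

Definition analytic (T : topologicalType) (A : set T) : Prop :=
  exists f : {ptws nat -> nat} -> T, continuous f /\ range f = A.

Record Fnorm (R : realType) (K : numFieldType) (E : lmodType K)
    (rho : E -> R) : Prop := {
  Fnorm_ge0 : forall x, 0 <= rho x;
  Fnorm_eq0 : forall x, rho x = 0 <-> x = 0;
  Fnorm_triangle : forall x y, rho (x + y) <= rho x + rho y;
  Fnorm_scale : forall (l : K) x, `|l| <= 1 -> rho (l *: x) <= rho x;
  Fnorm_cvg0 : forall x, (fun l : K => rho (l *: x)) @ (0 : K) --> (0 : R)
}.

Section BlockBases.
Variables (K : numFieldType) (E : lmodType K) (e : nat -> E).

(* Indices start at 0: the k-th block is {e_i | p k <= i < p (k+1)}. *)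
Definition in_block (p : nat -> nat) (k : nat) (x : E) : Prop :=
  x != 0 /\ lin_span (e @` [set i | (p k <= i < p k.+1)%N]) x.

Definition block_cuts (p : nat -> nat) : Prop :=
  p 0%N = 0%N /\ forall k, (p k < p k.+1)%N.

Definition block_basis : set (nat -> E) :=
  [set v | exists p, block_cuts p /\ forall k, in_block p k (v k)].

Definition fin_block_basis : set (seq E) :=
  [set s | exists p, block_cuts p /\
     forall k, (k < size s)%N -> in_block p k (nth 0 s k)].

Definition block_basis_in (A : set E) : set (nat -> E) :=
  [set v | block_basis v /\ forall k, A (v k)].

Definition block_subspace : set (set E) :=
  [set V | exists2 v, block_basis v & V = lin_span (range v)].

Definition large (sigma : set (nat -> E)) : Prop :=
  forall V, block_subspace V -> sigma `&` block_basis_in V !=set0.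

(* Only the values of Phi at finite block bases and block subspaces matter. *)
Definition strategy (Phi : seq E -> set E -> seq E) : Prop :=
  forall s V, fin_block_basis s -> block_subspace V ->
    fin_block_basis (Phi s V) /\ exists2 x, V x & Phi s V = rcons s x.

Fixpoint play (Phi : seq E -> set E -> seq E) (V : nat -> set E) (n : nat)
    : seq E :=
  if n is m.+1 then Phi (play Phi V m) (V m) else [::].

Definition outcome (Phi : seq E -> set E -> seq E) (V : nat -> set E)
    : nat -> E :=
  fun n => nth 0 (play Phi V n.+1) n.

Definition strategically_large (tau : set (nat -> E)) (V : set E) : Prop :=
  exists2 Phi, strategy Phi &
    forall W : nat -> set E,
      (forall j, block_subspace (W j)) -> (forall j, W j `<=` V) ->
      tau (outcome Phi W).

Section Distance.
Variables (R : realType) (rho : nat -> E -> R).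

Definition seq_dist (u v : nat -> E) : \bar R :=
  (\sum_(0 <= j <oo) (rho j (u j - v j))%:E)%E.

Definition enlargement (sigma : set (nat -> E)) (eps : R) : set (nat -> E) :=
  [set u | block_basis u /\
     (ereal_inf [set seq_dist u v | v in sigma] < eps%:E)%E].

End Distance.
End BlockBases.

(* Main.v *)
Require Import Defs.
From HB Require Import structures.
From mathcomp Require Import all_boot all_order all_algebra complex.
From mathcomp Require Import all_classical all_reals all_analysis.
Import Order.TTheory GRing.Theory Num.Theory.
Import numFieldTopology.Exports numFieldNormedType.Exports.
Set Implicit Arguments.
Unset Strict Implicit.
Unset Printing Implicit Defensive.
Local Open Scope classical_set_scope.
Local Open Scope ring_scope.

(** Write [sigma] as the image of a continuous [f] on the Baire space, and let
[branch s] be the image of the sequences that extend the finite sequence [s].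
Because the sets [C n] meet each finite-dimensional subspace in a compact set,
the vectors of [C n] whose last nonzero coordinate is a given one are covered
by finitely many cells of small [rho n]-diameter, so a finite run of the game
can be recorded by a finite code [p], a sequence of cells.  A position is a
pair [(p, s)]; it is large for [V] when every block subspace of [V] contains
the tail of some member of [branch s] whose first entries lie in the cells of
[p].

From a large position the second player plays vectors in the cells chosen so
far and aims to reveal one more integer: to move from [(p, s)] to a large
position [(p', rcons s m)], with [p'] extending [p].  Repeating this forever
produces a branch [mu] such that, for every [n], some member of the branch of
[mu] restricted to [n] shares its first [n] cells with the outcome [u]; by
continuity of [f] the outcome is then within [eps] of [f mu], a point of
[sigma] (lemmas [advances_limit] and [continuous_branch_approx]).

The point is that, inside a suitable [V], revealing one more integer is always
possible from a large position (lemma [large_reaches]).  Revealing is an open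
goal, so the dichotomy for open games applies: if the goal cannot be forced in
any subspace of [V], then there is [Z] inside [V] whose vectors never lead to a
position where an integer can be revealed.  Largeness supplies a [v] in
[branch s] with its tail in [Z], and [v] lies in [branch (rcons s m)] for some
[m].  Following [v] long enough gives a code [p'] at which [m] cannot be
revealed, that is, [(p', rcons s m)] is not large; since [V] was refined so that
a position either is large or has no continuation at all in [V], this
contradicts the existence of [v].

The subspace [Z] comes from a diagonal construction (lemma [fusion]) that can
meet only finitely many requirements before each new basis vector is chosen.
That is why [m] may only be revealed once the vectors played reach the [m]-th
coordinate: below each height there are then finitely many positions, even
though infinitely many integers could follow [s], and the delay costs nothing
since the supports of a block basis tend to infinity. *)

(** * Spans, coordinates and block subspaces *)

Section LinearSpans.
Variables (K : numFieldType) (E : lmodType K).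
Implicit Types (A B : set E) (x y : E).

Lemma lin_span_gen A x : A x -> lin_span A x.
Proof.
by move=> Ax; exists 1%N, (fun=> 1), (fun=> x); rewrite big_ord1 scale1r.
Qed.

Lemma lin_span0 A : lin_span A 0.
Proof.
by exists 0%N, (fun=> 0), (fun=> 0); rewrite big_ord0; split=> // -[].
Qed.

Lemma lin_spanD A x y : lin_span A x -> lin_span A y -> lin_span A (x + y).
Proof.
move=> [n [a [b [Ab ->]]]] [m [c [d [Ad ->]]]]; exists (n + m)%N.
exists (fun i => match fintype.split i with inl j => a j | inr j => c j end).
exists (fun i => match fintype.split i with inl j => b j | inr j => d j end).
split=> [i|]; first by case: (fintype.split i).
rewrite big_split_ord /=; congr (_ + _); apply: eq_bigr => i _.
  by rewrite (unsplitK (inl i)).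
by rewrite (unsplitK (inr i)).
Qed.

Lemma lin_spanZ A (l : K) x : lin_span A x -> lin_span A (l *: x).
Proof.
move=> [n [a [b [Ab ->]]]]; exists n, (fun i => l * a i), b; split=> //.
by rewrite scaler_sumr; apply: eq_bigr => i _; rewrite scalerA.
Qed.

Lemma lin_span_sum A n (F : 'I_n -> E) :
  (forall i, lin_span A (F i)) -> lin_span A (\sum_(i < n) F i).
Proof.
by move=> AF; elim/big_ind: _ => //; [exact: lin_span0|exact: lin_spanD].
Qed.

Lemma lin_span_min A B : A `<=` lin_span B -> lin_span A `<=` lin_span B.
Proof.
move=> AB x [n [a [b [Ab ->]]]]; apply: lin_span_sum => i.
by apply: lin_spanZ; exact: AB.
Qed.

Lemma sum_ord_widen (z : nat -> E) (a : nat -> K) N M :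
  (forall i, (N <= i)%N -> a i = 0) -> (N <= M)%N ->
  \sum_(i < M) a i *: z i = \sum_(i < N) a i *: z i.
Proof.
move=> a0 NM; rewrite [RHS](big_ord_widen M (fun i => a i *: z i)) //.
rewrite [RHS]big_mkcond; apply: eq_bigr => i _.
by case: ltnP => // /a0 ->; rewrite scale0r.
Qed.

Lemma lin_span_range (z : nat -> E) x : lin_span (range z) x ->
  exists (L : nat) (a : nat -> K),
    (forall i, (L <= i)%N -> a i = 0) /\ x = \sum_(i < L) a i *: z i.
Proof.
move=> [n [c [b [zb ->]]]]; elim: n c b zb => [|n IH] c b zb.
  by exists 0%N, (fun=> 0); rewrite !big_ord0.
rewrite big_ord_recr /=.
have [L [a [a0 ->]]] := IH (fun i => c (widen_ord (leqnSn n) i))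
  (fun i => b (widen_ord (leqnSn n) i)) (fun i => zb _).
have [k _ <-] := zb ord_max; set l := c ord_max.
pose g i := if i == k then l else 0.
have g0 i : (k < i)%N -> g i = 0 by move=> ki; rewrite /g gtn_eqF.
exists (maxn L k.+1), (fun i => a i + g i); split.
  by move=> i; rewrite geq_max => /andP[/a0 -> /g0 ->]; rewrite addr0.
under [RHS]eq_bigr do rewrite scalerDl.
rewrite big_split (sum_ord_widen _ a0) ?leq_maxl //; congr (_ + _).
rewrite (sum_ord_widen _ g0) ?leq_maxr // big_ord_recr /= {2}/g eqxx.
by rewrite big1 ?add0r // => i _; rewrite /g ltn_eqF // scale0r.
Qed.

End LinearSpans.

Section Coordinates.
Variables (K : numFieldType) (E : lmodType K) (e : nat -> E).

Definition expansion (x : E) (a : nat -> K) : Prop :=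
  exists N, (forall i, (N <= i)%N -> a i = 0) /\ x = \sum_(i < N) a i *: e i.

Definition hcoef (x : E) : nat -> K := xget (fun=> 0) (expansion x).

(** Supports are tracked by where they start ([tail]) and where they end
    ([deg]);
    [deg x b] means that the support of [x] has maximum [b - 1], so that [b] is
    also the first index allowed to a later block. *)
Definition tail (N : nat) : set E :=
  [set x | forall i, (i < N)%N -> hcoef x i = 0].

Definition deg (x : E) (b : nat) : Prop :=
  [/\ (0 < b)%N, hcoef x b.-1 != 0 & forall i, (b <= i)%N -> hcoef x i = 0].

Hypothesis he : hamel_basis e.

Lemma expansion_uniq x a b : expansion x a -> expansion x b -> a = b.
Proof.
move=> [N [a0 ->]] [M [b0 eqab]]; apply/funext => i.
pose L := maxn i.+1 (maxn N M).
have NL : (N <= L)%N by rewrite /L leq_max leq_max leqnn orbT.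
have ML : (M <= L)%N by rewrite /L leq_max leq_max leqnn !orbT.
have iL : (i < L)%N by rewrite leq_max leqnn.
apply/eqP; rewrite -subr_eq0; apply/eqP.
apply: (he.1 L (fun i : 'I_L => a i - b i) _ (Ordinal iL)).
under eq_bigr do rewrite scalerBl.
rewrite sumrB (sum_ord_widen _ a0 NL) (sum_ord_widen _ b0 ML) eqab.
exact: subrr.
Qed.

Lemma hcoef_expansion x : expansion x (hcoef x).
Proof.
have: [set: E] x by []; rewrite -he.2 => /lin_span_range [L [a aP]].
by apply: (@xgetPex _ (fun=> 0) (expansion x)); exists a, L.
Qed.

Lemma hcoefE x a : expansion x a -> hcoef x = a.
Proof. exact: expansion_uniq (hcoef_expansion x). Qed.

Lemma hcoefP (l : K) x y i : hcoef (l *: x + y) i = l * hcoef x i + hcoef y i.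
Proof.
have [N [x0 xE]] := hcoef_expansion x; have [M [y0 yE]] := hcoef_expansion y.
suff /hcoefE -> :
  expansion (l *: x + y) (fun i => l * hcoef x i + hcoef y i) by [].
exists (maxn N M); split=> [j|].
  by rewrite geq_max => /andP[/x0 -> /y0 ->]; rewrite mulr0 addr0.
under eq_bigr do rewrite scalerDl -scalerA.
rewrite big_split /= -scaler_sumr (sum_ord_widen _ x0) ?leq_maxl //.
by rewrite (sum_ord_widen _ y0) ?leq_maxr // -xE -yE.
Qed.

Lemma hcoef0 i : hcoef 0 i = 0.
Proof.
suff /hcoefE -> : expansion 0 (fun=> 0) by [].
by exists 0%N; rewrite big_ord0.
Qed.

Lemma hcoefZ l x i : hcoef (l *: x) i = l * hcoef x i.
Proof. by rewrite -[l *: x]addr0 hcoefP hcoef0 addr0. Qed.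

Lemma hcoefD x y i : hcoef (x + y) i = hcoef x i + hcoef y i.
Proof. by rewrite -[x in LHS]scale1r hcoefP mul1r. Qed.

Lemma hcoef_sum n (F : 'I_n -> E) i :
  hcoef (\sum_(j < n) F j) i = \sum_(j < n) hcoef (F j) i.
Proof. by elim/big_ind2: _ => [|x a y b <- <-|]; rewrite ?hcoef0 ?hcoefD. Qed.

Lemma hcoef_basis j i : hcoef (e j) i = (i == j)%:R.
Proof.
suff /hcoefE -> : expansion (e j) (fun i => (i == j)%:R) by [].
exists j.+1; split=> [k jk|]; first by rewrite gtn_eqF.
rewrite big_ord_recr /= eqxx scale1r big1 ?add0r // => k _.
by rewrite ltn_eqF // scale0r.
Qed.

Lemma hcoef_eq0 x : (forall i, hcoef x i = 0) -> x = 0.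
Proof.
move=> x0; have [N [_ ->]] := hcoef_expansion x.
by rewrite big1 // => i _; rewrite x0 scale0r.
Qed.

Lemma lin_span_support (P : set nat) x :
  lin_span (e @` P) x <-> forall i, hcoef x i != 0 -> P i.
Proof.
split=> [[n [a [b [Pb ->]]]] i|xP].
  rewrite hcoef_sum => si; apply: contrapT => Pi; case/eqP: si.
  apply: big1 => j _; have [k Pk <-] := Pb j.
  rewrite hcoefZ hcoef_basis; case: eqP => [ik|_]; last by rewrite mulr0.
  by rewrite ik in Pi.
have [N [_ ->]] := hcoef_expansion x; apply: lin_span_sum => i.
have [->|xi] := eqVneq (hcoef x i) 0.
  by rewrite scale0r; exact: lin_span0.
by apply: lin_spanZ; apply: lin_span_gen; exists (i : nat) => //; exact: xP.
Qed.

Lemma tailS N M : (N <= M)%N -> tail M `<=` tail N.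
Proof. by move=> NM x xM i iN; apply: xM; exact: leq_trans NM. Qed.

Lemma deg_exists x : x != 0 -> exists b, deg x b.
Proof.
move=> x0; have [N [xN _]] := hcoef_expansion x; elim: N xN => [|N IH] xN.
  by case/eqP: x0; apply: hcoef_eq0 => i; exact: xN.
have [xN0|xN0] := eqVneq (hcoef x N) 0; last by exists N.+1; split.
apply: IH => i; rewrite leq_eqVlt => /predU1P[<- //|]; exact: xN.
Qed.

Lemma deg_neq0 x b : deg x b -> x != 0.
Proof. by case=> _ + _; apply: contra_neq => ->; rewrite hcoef0. Qed.

Lemma deg_uniq x b c : deg x b -> deg x c -> b = c.
Proof.
move=> [b0 xb bx] [c0 xc cx]; apply/eqP; rewrite eqn_leq; apply/andP; split.
  rewrite leqNgt; apply: contra_neqN xb => cb; apply: cx.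
  by rewrite -ltnS prednK.
rewrite leqNgt; apply: contra_neqN xc => bc; apply: bx.
by rewrite -ltnS prednK.
Qed.

Lemma deg_tail x b N : deg x b -> tail N x -> (N < b)%N.
Proof.
move=> [b0 xb _] xN; rewrite ltnNge; apply: contra_neqN xb => bN; apply: xN.
by rewrite prednK.
Qed.

Lemma in_blockP p k x : in_block e p k x <->
  [/\ x != 0, tail (p k) x & forall i, (p k.+1 <= i)%N -> hcoef x i = 0].
Proof.
rewrite /in_block lin_span_support; split=> [[x0 xP]|[x0 xl xr]]; split=> //.
- move=> i ip; apply/eqP; apply: contraTT ip => /xP /andP[pi _].
  by rewrite -leqNgt.
- move=> i ip; apply/eqP; apply: contraTT ip => /xP /andP[_ pi].
  by rewrite -ltnNge.
move=> i xi; apply/andP; split.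
  by rewrite leqNgt; apply: contra_neqN xi; exact: xl.
by rewrite ltnNge; apply: contra_neqN xi; exact: xr.
Qed.

(** Normal form of a block basis: the cuts are placed right after the supports,
    so that they are determined by the vectors (except for the first one). *)
Definition blocks (N : nat -> nat) (v : nat -> E) : Prop :=
  forall n, tail (N n) (v n) /\ deg (v n) (N n.+1).

Lemma blocks_ltn N v : blocks N v -> forall n, (N n < N n.+1)%N.
Proof. by move=> Nv n; have [vt vd] := Nv n; exact: deg_tail vd vt. Qed.

Lemma blocks_leq N v : blocks N v -> {homo N : m n / (m <= n)%N}.
Proof.
move=> Nv; apply: homo_leq => [//|m n p|n]; first exact: leq_trans.
by rewrite ltnW // (blocks_ltn Nv).
Qed.

Lemma blocks_geq_id N v : blocks N v -> forall n, (n <= N n)%N.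
Proof.
move=> Nv; elim=> // n IH; exact: leq_ltn_trans IH (blocks_ltn Nv n).
Qed.

Lemma block_basisP v : block_basis e v <-> exists N, blocks N v.
Proof.
split=> [[p [[p0 plt] vp]]|[N Nv]].
  have v0 n : v n != 0 by have [] := vp n.
  have [d dv] := choice (fun n => deg_exists (v0 n)).
  exists (fun n => if n is m.+1 then d m else 0%N) => n; split=> //.
  case: n => [//|n]; have /in_blockP [_ vt _] := vp n.+1.
  apply: tailS vt; have /in_blockP [_ _ vr] := vp n.
  have [d0 vd _] := dv n; rewrite leqNgt; apply: contra_neqN vd => dp.
  by apply: vr; rewrite -ltnS prednK.
pose p n := if n is m.+1 then N n else 0%N.
exists p; split.
  split=> // -[|n] /=; last exact: blocks_ltn Nv _.
  exact: leq_ltn_trans (blocks_ltn Nv 0).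
move=> k; apply/in_blockP; have [vt vd] := Nv k; split.
- exact: deg_neq0 vd.
- by case: k vt {vd} => //= _ i.
- by case: vd.
Qed.

(** The last coordinate of a block meets no other block, hence it reads off the
    coefficient of that block in a linear combination. *)
Lemma blocks_hcoef_sum N z L (a : nat -> K) l : blocks N z -> (l < L)%N ->
  hcoef (\sum_(i < L) a i *: z i) (N l.+1).-1 =
  a l * hcoef (z l) (N l.+1).-1.
Proof.
move=> Nz lL; rewrite hcoef_sum (bigD1 (Ordinal lL)) //= hcoefZ big1 ?addr0 //.
move=> i il; rewrite hcoefZ; have [zt [_ _ zd]] := Nz i.
have Nl := blocks_ltn Nz l; have N0 := leq_ltn_trans (leq0n _) Nl.
case: (ltngtP i l) => [lt_il|lt_li|eq_il].
- rewrite zd ?mulr0 // -ltnS prednK //.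
  by apply: leq_ltn_trans Nl; exact: blocks_leq Nz _ _ lt_il.
- rewrite zt ?mulr0 // prednK //.
  exact: blocks_leq Nz _ _ lt_li.
- by rewrite -val_eqE /= eq_il eqxx in il.
Qed.

Lemma blocks_lead_neq0 N z l : blocks N z -> hcoef (z l) (N l.+1).-1 != 0.
Proof. by move=> Nz; have [_ []] := Nz l. Qed.

Lemma blocks_span_tail N z i w : blocks N z -> lin_span (range z) w ->
  tail (N i) w -> lin_span (z @` [set l | (i <= l)%N]) w.
Proof.
move=> Nz /lin_span_range [L [a [_ ->]]] wt; apply: lin_span_sum => l.
have [il|li] := leqP i l.
  by apply: lin_spanZ; apply: lin_span_gen; exists (l : nat).
suff -> : a l = 0 by rewrite scale0r; exact: lin_span0.
have := blocks_hcoef_sum a Nz (ltn_ord l); rewrite wt; last first.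
  rewrite prednK; last exact: leq_ltn_trans (blocks_ltn Nz l).
  exact: blocks_leq Nz _ _ li.
by move=> /esym /eqP; rewrite mulf_eq0 (negPf (blocks_lead_neq0 l Nz)) orbF
  => /eqP.
Qed.

Lemma blocks_span_deg N z w b : blocks N z -> lin_span (range z) w ->
  deg w b -> exists l, b = N l.+1.
Proof.
move=> Nz /lin_span_range [L [a [_ ->]]]; elim: L => [|L IH] wd.
  by have := deg_neq0 wd; rewrite big_ord0 eqxx.
have [aL|aL] := eqVneq (a L) 0.
  by apply: IH; move: wd; rewrite big_ord_recr /= aL scale0r addr0.
exists L; apply: deg_uniq wd _; split.
- exact: leq_ltn_trans (blocks_ltn Nz L).
- by rewrite (blocks_hcoef_sum a Nz) // mulf_neq0 // blocks_lead_neq0.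
move=> i Ni; rewrite hcoef_sum big1 // => j _; rewrite hcoefZ.
have [_ [_ _ zd]] := Nz j; rewrite zd ?mulr0 //; apply: leq_trans Ni.
exact: blocks_leq Nz _ _ (ltn_ord j).
Qed.

Lemma block_subspace_span N z : blocks N z ->
  block_subspace e (lin_span (range z)).
Proof. by move=> Nz; exists z => //; apply/block_basisP; exists N. Qed.

Lemma block_subspaceP V : block_subspace e V <->
  exists N z, blocks N z /\ V = lin_span (range z).
Proof.
split=> [[z /block_basisP [N Nz] ->]|[N [z [Nz ->]]]]; first by exists N, z.
exact: block_subspace_span Nz.
Qed.

Lemma block_subspace_tail V n : block_subspace e V ->
  exists2 V', block_subspace e V' & V' `<=` V `&` tail n.
Proof.
move=> /block_subspaceP [N [z [Nz ->]]].
have Nz' : blocks (fun i => N (n + i)%N) (fun i => z (n + i)%N).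
  by move=> i; rewrite /= addnS; exact: Nz.
exists (lin_span (range (fun i => z (n + i)%N))).
  exact: block_subspace_span Nz'.
move=> x xV; split.
  apply: lin_span_min xV => _ [i _ <-]; apply: lin_span_gen.
  by exists (n + i)%N.
have [L [a [_ ->]]] := lin_span_range xV => j jn.
rewrite hcoef_sum big1 // => i _; rewrite hcoefZ.
have [zt _] := Nz (n + i)%N; rewrite zt ?mulr0 //.
apply: leq_trans jn (leq_trans _ (blocks_geq_id Nz _)); exact: leq_addr.
Qed.

Lemma block_subspace_vec V n : block_subspace e V ->
  exists x b, [/\ V x, tail n x & deg x b].
Proof.
move=> /(block_subspace_tail n) [V' /block_subspaceP [N [z [Nz ->]]] V'V].
have [|zV zt] := V'V (z 0%N); first by apply: lin_span_gen; exists 0%N.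
by exists (z 0%N), (N 1%N); split=> //; case: (Nz 0%N).
Qed.

Lemma block_subspace_span_sub V A : block_subspace e V ->
  A `<=` V -> lin_span A `<=` V.
Proof. by move=> [z _ ->] AV; exact: lin_span_min. Qed.

Lemma block_subspaceT : block_subspace e setT.
Proof.
exists e; last by rewrite he.2.
apply/block_basisP; exists id => n; split=> [i ni|].
  by rewrite hcoef_basis ltn_eqF.
split=> //= [|i ni]; first by rewrite hcoef_basis eqxx oner_eq0.
by rewrite hcoef_basis gtn_eqF.
Qed.

End Coordinates.

(** * The finest vector topology and F-norms *)

(** [compact_cover] is about pointed spaces. *)
HB.instance Definition _ (K : numFieldType) (E : lmodType K) :=
  isPointed.Build (finest E) 0.

Section Topology.
Variables (R : realType) (K : numFieldType) (E : lmodType K).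

Lemma FnormN (rho : E -> R) (hrho : Fnorm rho) x : rho (- x) = rho x.
Proof.
apply/eqP; rewrite eq_le -{3}(opprK x) -!(scaleN1r x) -(scaleN1r (_ *: x)).
by rewrite !(Fnorm_scale hrho) // normrN1.
Qed.

(** On a finite-dimensional subspace [rho] is continuous, by the triangle
    inequality and the continuity of [rho] along each of the basis vectors. *)
Lemma Fnorm_ball_open (rho : E -> R) (hrho : Fnorm rho) (w : E) (d : R) :
  open ([set y | rho (y - w) < d] : set (finest E)).
Proof.
move=> n b _; rewrite openE => a /= ad.
have coord i : (fun a' : 'rV[K]_n => a' 0 i - a 0 i) @ a --> (0 : K).
  have ai : (fun a' : 'rV[K]_n => a' 0 i) @ a --> a 0 i.
    exact: coord_continuous.
  by rewrite -(subrr (a 0 i)); exact: cvgB ai (cvg_cst _).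
have small : (fun a' : 'rV[K]_n => \sum_(i < n) rho ((a' 0 i - a 0 i) *: b i))
    @ a --> (0 : R).
  rewrite [X in _ --> X](_ : _ = \sum_(i < n) (0 : R)); last by rewrite big1.
  apply: (@cvg_big _ _ _ _ _ (@add_continuous R) _ (nbhs a)) => i _.
  exact: cvg_comp (coord i) (Fnorm_cvg0 hrho (b i)).
have /cvgrPdist_lt /(_ (d - rho (\sum_(i < n) a 0 i *: b i - w))) := small.
rewrite subr_gt0 => /(_ ad); rewrite /interior; apply: filterS => a' /=.
rewrite sub0r normrN => a'd.
have -> : \sum_(i < n) a' 0 i *: b i - w =
    \sum_(i < n) (a' 0 i - a 0 i) *: b i + (\sum_(i < n) a 0 i *: b i - w).
  rewrite addrA -big_split /=; congr (_ - _); apply: eq_bigr => i _.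
  by rewrite -scalerDl subrK.
apply: le_lt_trans (Fnorm_triangle hrho _ _) _; rewrite -ltrBrDr.
apply: le_lt_trans (le_lt_trans (ler_norm _) a'd).
elim/big_ind2: _ => [|x y z t xy zt|//].
  by rewrite (proj2 (Fnorm_eq0 hrho 0)).
by apply: le_trans (Fnorm_triangle hrho _ _) _; apply: lerD.
Qed.

Lemma compact_finite_net (rho : E -> R) (hrho : Fnorm rho) (A : set E) (d : R) :
  0 < d -> compact (A : set (finest E)) ->
  exists s : seq E, forall y, A y ->
    exists2 i, (i < size s)%N & rho (y - nth 0 s i) < d.
Proof.
move=> d0; rewrite compact_cover.
move=> /(_ (finest E) A (fun w => [set y | rho (y - w) < d])) [].
- by move=> w _; exact: Fnorm_ball_open.
- by move=> y Ay; exists y => //=; rewrite subrr (proj2 (Fnorm_eq0 hrho 0)).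
move=> D _ cov; exists (finmap.enum_fset D) => y /cov [w /= wD yw].
by exists (index w (finmap.enum_fset D)); rewrite ?index_mem // nth_index.
Qed.

(** Sequences that agree with [mu] on longer and longer initial segments
    converge to [mu], hence the entries of their images converge as well. *)
Lemma continuous_branch_approx (rho : E -> R) (hrho : Fnorm rho)
    (f : {ptws nat -> nat} -> {ptws nat -> finest E}) (fc : continuous f)
    (mu : nat -> nat) (nu : nat -> nat -> nat)
    (num : forall i k, (k < i)%N -> nu i k = mu k) (j : nat) (d : R) :
  0 < d ->
  \forall i \near \oo, rho (f (nu i) j - f mu j) < d.
Proof.
move=> d0.
have nucvg : {ptws, nu @ \oo --> mu}.
  apply/pointwise_cvgP => k; rewrite /= -fmap_comp.
  apply: (@cvg_near_cst _ _ _ _ _ _) => //.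
  by exists k.+1 => // i /=; apply: num.
have fjc : (fun i => f (nu i) j) @ \oo --> (f mu j : finest E).
  apply: (cvg_comp nu (fun m => f m j) nucvg).
  exact: (cvg_comp f (fun g => g j) (fc mu) (@proj_continuous _ _ j (f mu))).
apply: (fjc [set y | rho (y - f mu j) < d]).
apply: open_nbhs_nbhs; split; first exact: Fnorm_ball_open.
by rewrite /= subrr (proj2 (Fnorm_eq0 hrho 0)).
Qed.

End Topology.

(** * Diagonal block subspaces *)

Section Fusion.
Variables (K : numFieldType) (E : lmodType K) (e : nat -> E).
Hypothesis he : hamel_basis e.

(** A block basis [z] is built with [z i] in [W i], where the decreasing [W i]
    meet the finitely many requirements of height at most the degree [N i]
    reached so far.  A requirement whose height is one of the [N i] only looks
    at the vectors of [Z] that start at [N i] or later; those are combinations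
    of the [z j] with [j >= i], which lie in [W i].  Heights strictly between
    two of the [N i] are out of reach: [z i] may start after such a height,
    although it was chosen in a subspace that need not meet the requirement. *)
Lemma fusion (P : eqType) (legit : set P) (h : P -> nat)
    (D : P -> set E -> Prop) (V : set E) (n0 : nat) :
  (forall n, exists l : seq P, forall p, legit p -> (h p <= n)%N -> p \in l) ->
  (forall p W, legit p -> block_subspace e W -> W `<=` V ->
     exists W', [/\ block_subspace e W', W' `<=` W & D p W']) ->
  (forall p W W', block_subspace e W' -> D p W ->
     W' `&` tail e (h p) `<=` W -> D p W') ->
  block_subspace e V ->
  exists Z, [/\ block_subspace e Z, Z `<=` V & forall p, legit p ->
    (h p <= n0)%N \/ (exists2 x, Z x & deg e x (h p)) -> D p Z].
Proof.
move=> fin dense local bV.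
have sub p W W' : block_subspace e W' -> W' `<=` W -> D p W -> D p W'.
  by move=> bW' W'W DW; apply: local DW _ => // x [/W'W].
have shrink W n : block_subspace e W -> W `<=` V -> exists W',
    [/\ block_subspace e W', W' `<=` W &
        forall p, legit p -> (h p <= n)%N -> D p W'].
  move=> bW WV; have [l lP] := fin n.
  suff [W' [bW' W'W DW']] : exists W', [/\ block_subspace e W', W' `<=` W &
      forall p, legit p -> p \in l -> D p W'].
    by exists W'; split=> // p lp pn; apply: DW' => //; exact: lP.
  elim: l {lP} => [|q l [W1 [bW1 W1W DW1]]]; first by exists W; split.
  have [lq|nlq] := pselect (legit q); last first.
    exists W1; split=> // p lp; rewrite inE => /predU1P[pq|].
      by rewrite -pq in nlq.
    exact: (DW1 p lp).
  have [W2 [bW2 W2W1 DW2]] := dense q W1 lq bW1 (subset_trans W1W WV).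
  exists W2; split=> // [|p lp]; first exact: subset_trans W1W.
  by rewrite inE => /predU1P[->//|pl]; apply: sub (DW1 p lp pl).
have /choice [F FP] (st : set E * nat) : exists st' : set E * E * nat,
    block_subspace e st.1 -> st.1 `<=` V ->
    [/\ block_subspace e st'.1.1, st'.1.1 `<=` st.1,
        forall p, legit p -> (h p <= st.2)%N -> D p st'.1.1,
        st'.1.1 st'.1.2 & tail e st.2 st'.1.2 /\ deg e st'.1.2 st'.2].
  have [[bW WV]|nWV] := pselect (block_subspace e st.1 /\ st.1 `<=` V).
    have [W' [bW' W'W DW']] := shrink st.1 st.2 bW WV.
    have [x [b [W'x xt xd]]] := block_subspace_vec he st.2 bW'.
    by exists (W', x, b).
  by exists (set0, 0, 0%N) => bW WV; case: nWV.
pose st := fix st n := if n is m.+1 then ((F (st m)).1.1, (F (st m)).2)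
  else (V, n0).
have stP n : block_subspace e (st n).1 /\ (st n).1 `<=` V.
  elim: n => [|n [bW WV]]; first by split.
  have [bW' W'W _ _ _] := FP _ bW WV; split=> //; exact: subset_trans W'W WV.
pose z n := (F (st n)).1.2; pose N n := (st n).2.
have zP n : [/\ (st n.+1).1 `<=` (st n).1,
    forall p, legit p -> (h p <= N n)%N -> D p (st n.+1).1,
    (st n.+1).1 (z n) & tail e (N n) (z n) /\ deg e (z n) (N n.+1)].
  by have [bW WV] := stP n; have [] := FP _ bW WV.
have decr i j : (i <= j)%N -> (st j).1 `<=` (st i).1.
  move=> /subnKC <-; elim: (j - i)%N => [|k IH]; first by rewrite addn0.
  by rewrite addnS; apply: subset_trans IH; case: (zP (i + k)%N).
have Nz : blocks e N z by move=> n; have [] := zP n.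
exists (lin_span (range z)); split.
- exact: block_subspace_span Nz.
- apply: (block_subspace_span_sub bV) => _ [n _ <-].
  by have [_ _ + _] := zP n; exact: (stP n.+1).2.
move=> p lp hp.
have [i [hpi Zi]] : exists i, (h p <= N i)%N /\
    lin_span (range z) `&` tail e (h p) `<=` (st i.+1).1.
  case: hp => [hp|[x Zx xd]]; first (exists 0%N; split=> //).
    move=> x [Zx _]; apply: (block_subspace_span_sub (stP 1%N).1) Zx.
    by move=> _ [j _ <-]; have [_ _ zj _] := zP j; exact: decr zj.
  have [l hl] := blocks_span_deg he Nz Zx xd; exists l.+1; rewrite hl.
  split=> // y [Zy yt].
  have zy := blocks_span_tail he Nz Zy yt.
  apply: (block_subspace_span_sub (stP l.+2).1 _ zy).
  by move=> _ [j lj <-]; have [_ _ zj _] := zP j; apply: decr zj; exact: lj.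
have [_ Di _ _] := zP i.
by apply: local (Di p lp hpi) Zi; exact: block_subspace_span Nz.
Qed.

End Fusion.

Lemma fin_seqs (T : eqType) (A : seq T) n : exists l : seq (seq T),
  forall r : seq T, (size r <= n)%N -> {subset r <= A} -> r \in l.
Proof.
elim: n => [|n [l lP]]; first by exists [:: [::]] => -[|x r] //.
exists ([::] :: [seq x :: r | x <- A, r <- l]) => -[//|x r] rn rA.
rewrite inE; apply/orP; right; apply: allpairs_f.
  by apply: rA; exact: mem_head.
by apply: lP => // y yr; apply: rA; rewrite inE yr orbT.
Qed.

(** * Positions and reachability of a reveal *)

Lemma path_ltn_last x s : path ltn x s ->
  (x + size s <= last x s)%N /\ forall y, y \in s -> (y <= last x s)%N.
Proof.
elim: s x => [|y s IH] x /=; first by rewrite addn0.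
move=> /andP[xy /IH [ys sy]]; split.
  by rewrite addnS -addSn; apply: leq_trans ys; rewrite leq_add2r.
move=> z; rewrite inE => /predU1P[->|/sy //].
exact: leq_trans (leq_addr _ _) ys.
Qed.

Section Reaching.
Variables (K : numFieldType) (E : lmodType K) (e : nat -> E).
Hypothesis he : hamel_basis e.

Variables (branch : seq nat -> set (nat -> E)).
Hypothesis branch_block : forall s, branch s `<=` block_basis e.
Hypothesis branch_split :
  forall s v, branch s v -> exists m, branch (rcons s m) v.

Variables (cell : nat -> nat * nat -> set E) (width : nat -> nat).
Hypothesis cell_deg : forall n c y, cell n c y -> deg e y c.1.
Hypothesis cell_width : forall n c y, cell n c y -> (c.2 < width c.1)%N.
Hypothesis branch_cell :
  forall s v, branch s v -> forall n, exists c, cell n c (v n).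

Implicit Types (V W : set E) (p : seq (nat * nat)) (s : seq nat).

(** A position code is a sequence of pairs [(b, i)]: the cell number [i] among
    those that cover vectors of degree [b].  The last degree is the coordinate
    from which the next vector may start. *)
Definition height p : nat := last 0%N (map fst p).

Definition fits p (v : nat -> E) : Prop :=
  forall j, (j < size p)%N -> cell j (nth (0%N, 0%N) p j) (v j).

Definition continues W p s (v : nat -> E) : Prop :=
  [/\ branch s v, fits p v & forall j, (size p <= j)%N -> W (v j)].

Definition large_from V p s : Prop :=
  forall W, block_subspace e W -> W `<=` V -> exists v, continues W p s v.

(** The bounds on [q.2] keep the number of positions of a given height
    finite. *)
Definition legit (q : seq (nat * nat) * seq nat) : Prop :=
  [/\ path ltn 0%N (map fst q.1), forall c, c \in q.1 -> (c.2 < width c.1)%N,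
      (size q.2 <= size q.1)%N &
      forall m, m \in q.2 -> (m <= height q.1)%N].

Definition reveals V p s : Prop :=
  exists2 m, (m <= height p)%N & large_from V p (rcons s m).

(** Well-founded trees branching over subspaces.  They bound the length of the
    play before a reveal, and thus keep a play from postponing it forever. *)
Inductive rank : Type := Zero | Sup of (set E -> rank).

(** The second player, answering inside [V], can force a reveal in at least one
    move, within the bound given by [t]. *)
Fixpoint wins V (t : rank) p s : Prop :=
  if t is Sup f then
    forall W, block_subspace e W -> W `<=` V -> exists y c,
      [/\ W y, tail e (height p) y, cell (size p) c y &
          reveals V (rcons p c) s \/ wins V (f W) (rcons p c) s]
  else False.

Definition reaches V p s : Prop := exists t, wins V t p s.

Definition barred V p s : Prop :=
  forall W, block_subspace e W -> W `<=` V -> ~ reaches W p s.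

(** The heights for which [fusion] meets its requirements. *)
Definition admissible V p : Prop :=
  height p = 0%N \/ exists2 x, V x & deg e x (height p).

(** Every subspace inherits the alternative that holds for [V], so that what
    fails for [V] fails for all its subspaces. *)
Definition decided V (q : seq (nat * nat) * seq nat) : Prop :=
  (large_from V q.1 q.2 \/ forall v, ~ continues V q.1 q.2 v) /\
  (reaches V q.1 q.2 \/ barred V q.1 q.2).

Lemma height_rcons p c : height (rcons p c) = c.1.
Proof. by rewrite /height map_rcons last_rcons. Qed.

Lemma legit_size q : legit q -> (size q.1 <= height q.1)%N.
Proof. by case=> /path_ltn_last []; rewrite size_map. Qed.

Lemma legit_fin n : exists l : seq (seq (nat * nat) * seq nat),
  forall q, legit q -> (height q.1 <= n)%N -> q \in l.
Proof.
pose A := [seq (b, i) | b <- iota 0 n.+1, i <- iota 0 (width b)].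
have [l1 l1P] := fin_seqs A n; have [l2 l2P] := fin_seqs (iota 0 n.+1) n.
exists [seq (p, s) | p <- l1, s <- l2] => -[p s] lq /= pn.
have psz := leq_trans (legit_size lq) pn.
have [/path_ltn_last [_ pb] pw ssz sb] := lq.
apply: allpairs_f.
  apply: l1P => // c cp; apply/allpairsPdep; exists c.1, c.2.
  split; last exact: surjective_pairing.
    rewrite mem_iota /= ltnS; apply: leq_trans pn; apply: pb; exact: map_f.
  by rewrite mem_iota /=; exact: pw.
apply: l2P; first exact: leq_trans ssz psz.
by move=> m ms; rewrite mem_iota /= ltnS; apply: leq_trans pn; exact: sb.
Qed.

Lemma legit_rcons p s c y : legit (p, s) -> tail e (height p) y ->
  cell (size p) c y -> legit (rcons p c, s).
Proof.
move=> [/= pp pw ssz sb] yt yc; have pc := deg_tail (cell_deg yc) yt.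
split=> /=.
- by rewrite map_rcons rcons_path pp.
- move=> d; rewrite mem_rcons inE => /predU1P[->|]; last exact: pw.
  exact: cell_width yc.
- by rewrite size_rcons leqW.
- by move=> m /sb; rewrite height_rcons => mp; exact: leq_trans mp (ltnW pc).
Qed.

Lemma legit_reveal p s m : legit (p, s) -> (size s < size p)%N ->
  (m <= height p)%N -> legit (p, rcons s m).
Proof.
move=> [/= pp pw ssz sb] sp mp; split=> //=; first by rewrite size_rcons.
by move=> k; rewrite mem_rcons inE => /predU1P[->//|]; exact: sb.
Qed.

Lemma fits_rcons p c v : fits p v -> cell (size p) c (v (size p)) ->
  fits (rcons p c) v.
Proof.
move=> pv cv j; rewrite size_rcons ltnS leq_eqVlt nth_rcons.
by move=> /predU1P[->|jp]; rewrite ?ltnn ?eqxx // jp; exact: pv.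
Qed.

(** The last cell of [p] records the exact degree of the vector it constrains,
    so the next blocks start after it.  Consequently only the part of a subspace
    beyond the height of [p] matters for the continuations of [p]. *)
Lemma fits_tail s p v j : branch s v -> fits p v -> (size p <= j)%N ->
  tail e (height p) (v j).
Proof.
move=> /branch_block /(block_basisP he) [N Nv].
case/lastP: p => [|p c]; first by move=> _ _ i.
rewrite size_rcons height_rcons => /(_ (size p)).
rewrite size_rcons nth_rcons ltnn eqxx ltnS leqnn => /(_ isT) /cell_deg cd pj.
have [_ vd] := Nv (size p); rewrite (deg_uniq cd vd).
by have [+ _] := Nv j; apply: tailS; exact: blocks_leq Nv _ _ pj.
Qed.

Lemma continues_local W W' p s v : continues W' p s v ->
  W' `&` tail e (height p) `<=` W -> continues W p s v.
Proof.
move=> [sv pv vW'] W'W; split=> // j pj; apply: W'W; split; first exact: vW'.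
exact: fits_tail sv pv pj.
Qed.

(** A block subspace of [V'] has a block subspace beyond any coordinate, so that
    finite-dimensional modifications of [V] preserve largeness; [reaches_local]
    holds for the same reason. *)
Lemma large_local V V' n p s : large_from V p s ->
  V' `&` tail e n `<=` V -> large_from V' p s.
Proof.
move=> Vps V'V W bW WV'; have [W1 bW1 W1W] := block_subspace_tail he n bW.
have [|v [sv pv vW1]] := Vps W1 bW1.
  by move=> x /W1W [/WV' V'x xt]; exact: V'V.
by exists v; split=> // j /vW1 /W1W [].
Qed.

Lemma reaches_step V p s :
  (forall W, block_subspace e W -> W `<=` V -> exists y c,
    [/\ W y, tail e (height p) y, cell (size p) c y &
        reveals V (rcons p c) s \/ reaches V (rcons p c) s]) ->
  reaches V p s.
Proof.
move=> H.
have /choice [f fP] W : exists t, block_subspace e W -> W `<=` V ->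
    exists y c, [/\ W y, tail e (height p) y, cell (size p) c y &
        reveals V (rcons p c) s \/ wins V t (rcons p c) s].
  have [[bW WV]|nW] := pselect (block_subspace e W /\ W `<=` V).
    have [y [c [Wy yt yc [r|[t tP]]]]] := H W bW WV.
      by exists Zero => _ _; exists y, c; split=> //; left.
    by exists t => _ _; exists y, c; split=> //; right.
  by exists Zero => bW WV; case: nW.
by exists (Sup f).
Qed.

Lemma reaches_local V V' n p s : reaches V p s ->
  V' `&` tail e n `<=` V -> reaches V' p s.
Proof.
move=> [t tP] V'V; elim: t p tP => [//|f IH] p tP.
apply: reaches_step => W bW WV'.
have [W1 bW1 W1W] := block_subspace_tail he n bW.
have [|y [c [W1y yt yc H]]] := tP W1 bW1.
  by move=> x /W1W [/WV' V'x xt]; exact: V'V.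
exists y, c; split=> //; first by have [] := W1W y W1y.
case: H => [[m mp Vm]|/IH]; last by right.
by left; exists m => //; exact: large_local Vm V'V.
Qed.

Lemma decided_local q W W' : block_subspace e W' -> decided W q ->
  W' `&` tail e (height q.1) `<=` W -> decided W' q.
Proof.
move=> bW' [lW rW] W'W; split.
  case: lW => [lW|kW]; first by left; exact: large_local lW W'W.
  right=> v vW'; apply: (kW v); exact: continues_local W'W.
case: rW => [rW|nW]; first by left; exact: reaches_local rW W'W.
right=> U bU UW' rU.
have [U1 bU1 U1U] := block_subspace_tail he (height q.1) bU.
apply: (nW U1 bU1); first by move=> x /U1U [/UW' W'x xt]; exact: W'W.
by apply: (reaches_local (n := 0%N) rU) => x [/U1U []].
Qed.

Lemma decided_dense q W : block_subspace e W ->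
  exists W', [/\ block_subspace e W', W' `<=` W & decided W' q].
Proof.
move=> bW.
have [W1 [bW1 W1W lW1]] : exists W1, [/\ block_subspace e W1, W1 `<=` W &
    large_from W1 q.1 q.2 \/ forall v, ~ continues W1 q.1 q.2 v].
  have [lW|] := pselect (large_from W q.1 q.2).
    by exists W; split=> //; left.
  move=> /existsNP [W1 /not_implyP [bW1 /not_implyP [W1W kW1]]].
  exists W1; split=> //; right=> v vW1; apply: kW1; by exists v.
have [[W2 [bW2 W2W1 rW2]]|nW] := pselect (exists W2,
    [/\ block_subspace e W2, W2 `<=` W1 & reaches W2 q.1 q.2]); last first.
  exists W1; split=> //; split=> //; right=> U bU UW1 rU; apply: nW.
  by exists U.
exists W2; split=> //; first exact: subset_trans W1W.
split; last by left.
case: lW1 => [lW1|kW1]; [left|right].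
  by move=> U bU UW2; apply: lW1 => //; exact: subset_trans W2W1.
by move=> v [sv pv vW2]; apply: (kW1 v); split=> // j /vW2 /W2W1.
Qed.

Lemma decided_subspace V : block_subspace e V -> exists Z,
  [/\ block_subspace e Z, Z `<=` V &
      forall q, legit q -> admissible Z q.1 -> decided Z q].
Proof.
move=> bV.
have [Z [bZ ZV Zd]] := @fusion _ _ _ he _ legit (fun q => height q.1)
  (fun q W => decided W q) V 0%N legit_fin
  (fun q W _ bW _ => decided_dense q bW)
  (fun q W W' => @decided_local q W W') bV.
exists Z; split=> // q lq aq; apply: Zd => //.
by case: aq => [->|]; [left|right].
Qed.

(** If no move of the second player could be excluded, the reveal would be
    reachable in [W]; hence some subspace only allows moves after which it is
    not reachable in [W], therefore not in [V] either, and by [decided] in no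
    subspace of [V]. *)
Lemma barred_step V q W :
  (forall q, legit q -> admissible V q.1 -> decided V q) ->
  legit q -> barred V q.1 q.2 -> block_subspace e W -> W `<=` V ->
  exists W', [/\ block_subspace e W', W' `<=` W &
    forall y c, W' y -> tail e (height q.1) y -> cell (size q.1) c y ->
      ~ reveals V (rcons q.1 c) q.2 /\ barred V (rcons q.1 c) q.2].
Proof.
case: q => p s dV lq bar bW WV /=.
have [W1 [bW1 W1W nW1]] : exists W1, [/\ block_subspace e W1, W1 `<=` W &
    forall y c, W1 y -> tail e (height p) y -> cell (size p) c y ->
      ~ (reveals W (rcons p c) s \/ reaches W (rcons p c) s)].
  apply: contrapT => nW1; apply: (bar W bW WV).
  apply: reaches_step => W1 bW1 W1W.
  apply: contrapT => ny; apply: nW1; exists W1; split=> // y c W1y yt yc r.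
  by apply: ny; exists y, c.
have WV0 : W `&` tail e 0 `<=` V by move=> x [/WV].
exists W1; split=> // y c W1y yt yc; have nr := nW1 y c W1y yt yc; split.
  move=> [m mp Vm]; apply: nr; left; exists m => //.
  exact: large_local Vm WV0.
have [_ [rV|//]] : decided V (rcons p c, s).
  apply: dV; first exact: legit_rcons lq yt yc.
  right; exists y; first by apply/WV/W1W.
  by rewrite /= height_rcons; exact: cell_deg yc.
by case: nr; right; exact: reaches_local rV WV0.
Qed.

(** Otherwise [(p, s)] is barred, and [fusion] yields [Z] such that being barred
    passes along every play in [Z].  Largeness gives [v] in [branch s] with its
    tail in [Z], which also lies in some [branch (rcons s m)].  Following [v]
    until the height exceeds [m], the position [(p', rcons s m)] is not large,
    hence it has no continuation in [V] since it is decided; but [v] is one. *)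
Lemma large_reaches V p s : block_subspace e V ->
  (forall q, legit q -> admissible V q.1 -> decided V q) ->
  legit (p, s) -> admissible V p -> large_from V p s -> reaches V p s.
Proof.
move=> bV dV lps ap Vps; have [_ [//|/= bar]] := dV _ lps ap; exfalso.
pose D (q : seq (nat * nat) * seq nat) W := barred V q.1 q.2 ->
  forall y c, W y -> tail e (height q.1) y -> cell (size q.1) c y ->
    ~ reveals V (rcons q.1 c) q.2 /\ barred V (rcons q.1 c) q.2.
have Ddense q W : legit q -> block_subspace e W -> W `<=` V ->
    exists W', [/\ block_subspace e W', W' `<=` W & D q W'].
  move=> lq bW WV; have [bq|nbq] := pselect (barred V q.1 q.2).
    have [W' [bW' W'W W'D]] := barred_step dV lq bq bW WV.
    by exists W'; split=> // _.
  by exists W; split=> // /nbq.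
have Dlocal q W W' : block_subspace e W' -> D q W ->
    W' `&` tail e (height q.1) `<=` W -> D q W'.
  move=> _ DW W'W bq y c W'y yt yc.
  exact: (DW bq y c (W'W y (conj W'y yt)) yt yc).
have [Z [bZ ZV ZD]] := fusion he (height p) legit_fin Ddense Dlocal bV.
have [v [sv pv vZ]] := Vps Z bZ ZV.
have [m smv] := branch_split sv.
have [c cv] := choice (branch_cell sv).
have run k : exists p', [/\ legit (p', s), barred V p' s, fits p' v,
    size p' = (size p + k)%N &
    p' = p \/ (admissible Z p' /\ ~ reveals V p' s)].
  elim: k => [|k [p' [lp' bp' fp' sp' hp']]].
    by exists p; split=> //; [rewrite addn0|left].
  have pk : (size p <= size p')%N by rewrite sp' leq_addr.
  have yt := fits_tail sv fp' (leqnn _).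
  have yZ := vZ _ pk; have yc := cv (size p').
  have [nr bp1] : ~ reveals V (rcons p' (c (size p'))) s /\
      barred V (rcons p' (c (size p'))) s.
    apply: (ZD (p', s) lp' _ bp' _ _ yZ yt yc).
    by case: hp' => [->|[[h0|d] _]]; [left|left; rewrite /= h0|right].
  exists (rcons p' (c (size p'))); split=> //.
  - exact: legit_rcons lp' yt yc.
  - exact: fits_rcons.
  - by rewrite size_rcons sp' addnS.
  right; split=> //; right; exists (v (size p')) => //.
  by rewrite height_rcons; exact: cell_deg yc.
(* The length makes the height at least [m], so that [m] may be revealed, and
   leaves room for one more integer in [rcons s m]. *)
have [p' [lp' _ fp' sp' hp']] := run (m + size s).+1.
have ap' : admissible V p' /\ ~ reveals V p' s.
  case: hp' => [pp'|[[a0|[x Zx xd]] nr]]; last 2 first.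
  - by split=> //; left.
  - by split=> //; right; exists x => //; exact: ZV.
  by move: sp'; rewrite pp' => /eqP; rewrite -[X in X == _]addn0 eqn_add2l.
have [{}ap' nr] := ap'.
have mp' : (m <= height p')%N.
  apply: leq_trans (legit_size lp'); rewrite sp'.
  by rewrite addnS ltnW // addnCA ltnS leq_addr.
have lm : legit (p', rcons s m).
  by apply: legit_reveal => //; rewrite sp' addnS ltnS addnA leq_addl.
have [[Vm|kV] _] := dV _ lm ap'; first by apply: nr; exists m.
apply: (kV v); split=> // j jp'; apply: ZV; apply: vZ.
by apply: leq_trans jp'; rewrite sp' leq_addr.
Qed.

Definition state : Type := (seq (nat * nat) * seq nat * rank)%type.

(** One round of the winning play: either an integer is revealed, leading to a
    large position with an arbitrary new rank, or the rank drops to a child. *)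
Definition advances V (st : state) (x : E) (st' : state) : Prop :=
  let: (p, s, t) := st in let: (p', s', t') := st' in
  exists2 c, p' = rcons p c /\ (tail e (height p) x /\ cell (size p) c x) &
    (exists m, s' = rcons s m /\ large_from V p' s') \/
    (s' = s /\ exists f W, t = Sup f /\ t' = f W).

(** Ranks are well-founded, so that from each time on another integer is
    eventually revealed, and the revealed integers form a sequence [mu].  Each
    reveal leaves a large position, and a continuation of it in [V] is the
    required [v]. *)
Lemma advances_limit V (st : nat -> state) (u : nat -> E) :
  block_subspace e V -> large_from V [::] [::] ->
  (st 0%N).1 = ([::], [::]) ->
  (forall n, advances V (st n) (u n) (st n.+1)) ->
  block_basis e u /\ exists (c : nat -> nat * nat) (mu : nat -> nat),
    (forall j, cell j (c j) (u j)) /\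
    forall i, exists2 v, branch (mkseq mu i) v &
      forall j, (j < i)%N -> cell j (c j) (v j).
Proof.
move=> bV large0 st0 adv.
pose p n := (st n).1.1; pose s n := (st n).1.2; pose t n := (st n).2.
have advE n : exists2 c, p n.+1 = rcons (p n) c /\
    (tail e (height (p n)) (u n) /\ cell (size (p n)) c (u n)) &
    (exists m, s n.+1 = rcons (s n) m /\ large_from V (p n.+1) (s n.+1)) \/
    (s n.+1 = s n /\ exists f W, t n = Sup f /\ t n.+1 = f W).
  have := adv n; rewrite /p /s /t.
  by case: (st n) => -[? ?] ?; case: (st n.+1) => -[? ?] ?.
have [p0 s0] : p 0%N = [::] /\ s 0%N = [::] by rewrite /p /s st0.
have /choice [c cP] n : exists c, p n.+1 = rcons (p n) c /\
    (tail e (height (p n)) (u n) /\ cell (size (p n)) c (u n)).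
  by have [c cP _] := advE n; exists c.
have pE n : p n = mkseq c n.
  by elim: n => [//|n IH]; rewrite (cP n).1 IH mkseqS.
have psize n : size (p n) = n by rewrite pE size_mkseq.
have cu j : cell j (c j) (u j) by have [_ [_]] := cP j; rewrite psize.
have ublocks : blocks e (fun n => height (p n)) u.
  move=> n; split; first by have [_ []] := cP n.
  by rewrite (cP n).1 height_rcons; exact: cell_deg (cu n).
split; first by apply/(block_basisP he); exists (fun n => height (p n)).
have snext n : s n.+1 = s n \/ exists m, s n.+1 = rcons (s n) m.
  by have [_ _ [[m [-> _]]|[-> _]]] := advE n; [right; exists m|left].
have ssize n : (size (s n) <= n)%N.
  elim: n => [|n IH]; first by rewrite s0.
  by case: (snext n) => [->|[m ->]]; rewrite ?size_rcons ?ltnS // leqW.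
have sprefix n k i : (i < size (s n))%N ->
    (i < size (s (n + k)))%N /\ nth 0%N (s (n + k)%N) i = nth 0%N (s n) i.
  move=> isn; elim: k => [|k [IHs IHn]]; first by rewrite addn0.
  rewrite addnS -IHn; case: (snext (n + k)%N) => [->//|[m ->]].
  by rewrite size_rcons nth_rcons IHs leqW.
have snth n n' i : (i < size (s n))%N -> (i < size (s n'))%N ->
    nth 0%N (s n) i = nth 0%N (s n') i.
  move=> isn isn'; case: (leqP n n') => [|/ltnW] /subnKC <-.
    by have [_ ->] := sprefix n (n' - n)%N i isn.
  by have [_ ->] := sprefix n' (n - n')%N i isn'.
have reveal_later r n : t n = r -> exists n',
    size (s n') = (size (s n)).+1 /\ large_from V (p n') (s n').
  elim: r n => [|f IH] n tn; have [_ _ [[m [sn Vn]]|[sn [g [W [tnE tn']]]]]] :=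
    advE n; try by exists n.+1; rewrite {1}sn size_rcons.
    by rewrite tnE in tn.
  move: tnE; rewrite tn => -[fg]; rewrite -sn.
  by apply: (IH W); rewrite tn' fg.
have /choice [g gP] i : exists n, size (s n) = i /\ large_from V (p n) (s n).
  elim: i => [|i [n [<- _]]]; last exact: (reveal_later (t n)).
  by exists 0%N; rewrite s0 p0.
pose mu k := nth 0%N (s (g k.+1)) k.
exists c, mu; split=> // i; have [si Vi] := gP i.
have sE : s (g i) = mkseq mu i.
  apply: (@eq_from_nth _ 0%N) => [|k]; first by rewrite size_mkseq.
  rewrite si => ki.
  rewrite nth_mkseq //; apply: snth; first by rewrite si.
  by rewrite (gP k.+1).1.
have [v [sv pv _]] := Vi V bV (fun _ => id).
exists v; first by rewrite -sE.
move=> j ji; have gi : (i <= g i)%N by rewrite -{1}si.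
have jg := leq_trans ji gi; have := pv j.
by rewrite psize jg pE nth_mkseq // => /(_ isT).
Qed.

End Reaching.

(** * Strategies from state machines *)

Section Strategies.
Variables (K : numFieldType) (E : lmodType K) (e : nat -> E).
Hypothesis he : hamel_basis e.

Definition fin_blocks (u : seq E) (n : nat) : Prop :=
  exists p, [/\ block_cuts p,
    forall k, (k < size u)%N -> in_block e p k (nth 0 u k) & p (size u) = n].

Lemma fin_blocks_nil : fin_blocks [::] 0%N.
Proof. by exists id. Qed.

Lemma fin_block_basisP u : fin_block_basis e u <-> exists n, fin_blocks u n.
Proof.
by split=> [[p [pc pu]]|[n [p [pc pu _]]]]; [exists (p (size u)), p|exists p].
Qed.

Lemma fin_blocks_rcons u n x b : fin_blocks u n -> tail e n x -> deg e x b ->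
  fin_blocks (rcons u x) b.
Proof.
move=> [p [[p0 plt] pu <-]] xt xd; have pb := deg_tail xd xt.
pose q i := if (i <= size u)%N then p i else (b + (i - (size u).+1))%N.
have qE i : (i <= size u)%N -> q i = p i by rewrite /q => ->.
have qS : q (size u).+1 = b by rewrite /q ltnn subnn addn0.
exists q; rewrite size_rcons; split=> //.
  split=> [|k]; first by rewrite qE.
  have [ku|uk|->] := ltngtP k (size u).
  - by rewrite !qE // ltnW.
  - have kF : (k <= size u)%N = false by rewrite leqNgt uk.
    have kSF : (k < size u)%N = false by rewrite ltnNge ltnW.
    by rewrite /q kF kSF ltn_add2l subSS subnS ltn_predL subn_gt0.
  - by rewrite qS qE.
move=> k; rewrite ltnS nth_rcons leq_eqVlt => /predU1P[->|ku].
  rewrite ltnn eqxx; apply/(in_blockP he); rewrite qS qE //; split=> //.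
    exact: (deg_neq0 he xd).
  by case: xd.
rewrite ku; apply/(in_blockP he); rewrite (qE _ ku) (qE _ (ltnW ku)).
by apply/(in_blockP he); exact: pu.
Qed.

Lemma fin_block_basis_extend u W : fin_block_basis e u ->
  block_subspace e W -> exists2 x, W x & fin_block_basis e (rcons u x).
Proof.
move=> /fin_block_basisP [n un] bW.
have [x [b [Wx xt xd]]] := block_subspace_vec he n bW.
exists x => //; apply/fin_block_basisP; exists b.
exact: fin_blocks_rcons un xt xd.
Qed.

(** A strategy sees the vectors played so far but not the subspaces, so it
    cannot recompute the states that led to them.  It instead rebuilds a state
    from the vectors by choosing, for each of them, some legal transition that
    produces it; any such run of the machine serves the purpose. *)
Lemma strategy_of_machine (S : Type) (inv : seq E -> S -> Prop)
    (step : S -> E -> S -> Prop) (st0 : S) (V : set E) :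
  inv [::] st0 ->
  (forall u st W, inv u st -> block_subspace e W -> W `<=` V ->
     exists x st', [/\ W x, fin_block_basis e (rcons u x), step st x st' &
                       inv (rcons u x) st']) ->
  exists2 Phi, strategy e Phi & forall W : nat -> set E,
    (forall j, block_subspace e (W j)) -> (forall j, W j `<=` V) ->
    exists2 st : nat -> S, st 0%N = st0 &
      forall n, step (st n) (outcome Phi W n) (st n.+1).
Proof.
move=> inv0 Hstep.
have /choice [next nextP] (a : seq E * S * E) : exists st',
    (exists st', step a.1.2 a.2 st' /\ inv (rcons a.1.1 a.2) st') ->
    step a.1.2 a.2 st' /\ inv (rcons a.1.1 a.2) st'.
  have [[st' H]|nH] := pselect (exists st', step a.1.2 a.2 st' /\
    inv (rcons a.1.1 a.2) st'); first by exists st'.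
  by exists st0 => H; case: nH.
pose follow (a : seq E * S) x := (rcons a.1 x, next (a, x)).
pose track u := (foldl follow ([::], st0) u).2.
have foldE u : (foldl follow ([::], st0) u).1 = u.
  by elim/last_ind: u => [//|u x IH]; rewrite foldl_rcons /= IH.
have track_rcons u x : track (rcons u x) = next (u, track u, x).
  by rewrite /track foldl_rcons /= -{2}(foldE u) -surjective_pairing.
have /choice [phi phiP] (a : seq E * set E) : exists x, block_subspace e a.2 ->
    (fin_block_basis e a.1 -> a.2 x /\ fin_block_basis e (rcons a.1 x)) /\
    (inv a.1 (track a.1) -> a.2 `<=` V ->
       exists st', step (track a.1) x st' /\ inv (rcons a.1 x) st').
  case: a => u W /=.
  have [bW|nbW] := pselect (block_subspace e W); last by exists 0.
  have [[iu WV]|niu] := pselect (inv u (track u) /\ W `<=` V).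
    have [x [st' [Wx ux xst ix]]] := Hstep _ _ _ iu bW WV.
    by exists x => _; split=> // _ _; exists st'.
  have [bu|nbu] := pselect (fin_block_basis e u).
    have [x Wx ux] := fin_block_basis_extend bu bW.
    by exists x => _; split=> // iu WV; case: niu.
  by exists 0 => _; split=> // iu WV; case: niu.
pose Phi u W := rcons u (phi (u, W)).
exists Phi.
  move=> u W bu bW; have [/(_ bu) [Wx ux] _] := phiP (u, W) bW.
  by split=> //; exists (phi (u, W)).
move=> W bW WV.
have playS n : play Phi W n.+1 = rcons (play Phi W n) (phi (play Phi W n, W n)).
  by [].
have play_size n : size (play Phi W n) = n.
  by elim: n => [//|n IH]; rewrite playS size_rcons IH.
have outcomeE n : outcome Phi W n = phi (play Phi W n, W n).
  by rewrite /outcome playS nth_rcons play_size ltnn eqxx.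
have stepn n : inv (play Phi W n) (track (play Phi W n)) ->
    step (track (play Phi W n)) (outcome Phi W n) (track (play Phi W n.+1)) /\
    inv (play Phi W n.+1) (track (play Phi W n.+1)).
  move=> iu; have [_ /(_ iu (WV n)) H] := phiP (play Phi W n, W n) (bW n).
  rewrite outcomeE playS track_rcons.
  set v := play Phi W n in H *; exact: (nextP (v, track v, phi (v, W n))) H.
have invn n : inv (play Phi W n) (track (play Phi W n)).
  by elim: n => [//|n /stepn []].
exists (fun n => track (play Phi W n)) => // n.
by have [] := stepn n (invn n).
Qed.

End Strategies.

(** * Cells from compactness and the limit of a play *)

Section Main.
Variables (R : realType) (K : numFieldType) (E : lmodType K) (e : nat -> E).
Hypothesis he : hamel_basis e.

Lemma findim_deg b : exists2 F : set E, findim_subspace F &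
  forall y, deg e y b -> F y.
Proof.
exists (lin_span (range (fun i : 'I_b => e i))).
  by exists b, (fun i : 'I_b => e i).
move=> y [_ _ yb].
suff: lin_span (e @` [set i | (i < b)%N]) y.
  apply: lin_span_min => _ [i ib <-]; apply: lin_span_gen.
  by exists (Ordinal ib).
apply/(lin_span_support he) => i; rewrite /= ltnNge; apply: contra_neqN.
exact: yb.
Qed.

Lemma seq_dist_le (rho : nat -> E -> R) (u v : nat -> E) (eps : R) : 0 < eps ->
  (forall j, 0 <= rho j (u j - v j)) ->
  (forall j, rho j (u j - v j) <= eps / (2 ^ j.+1)%:R) ->
  (seq_dist rho u v <= eps%:E)%E.
Proof.
move=> eps0 rho0 le; apply: le_trans (epsilon_trick0 xpredT (ltW eps0)).
by apply: lee_nneseries => j _ *; rewrite lee_fin.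
Qed.

Lemma Fnorm_dist_lt (rho : E -> R) (hrho : Fnorm rho) (x y w : E) (a b : R) :
  rho (x - w) < a -> rho (y - w) < b -> rho (x - y) < a + b.
Proof.
move=> xw yw; rewrite -(subrK w x) -addrA.
apply: le_lt_trans (Fnorm_triangle hrho _ _) _; apply: ltrD => //.
by rewrite -(FnormN hrho) opprB.
Qed.

(** The cells have [rho n]-diameter less than [eps / 2 / 2 ^ n.+1], so that two
    sequences sharing all their cells are at distance at most [eps / 2]. *)
Lemma enlargement_strategically_large (sigma : set (nat -> E))
    (sigma_block : sigma `<=` block_basis e) (sigma_large : large e sigma)
    (C : nat -> set E)
    (C_compact : forall n (F : set E), findim_subspace F ->
       compact (C n `&` F : set (finest E)))
    (sigma_sub_C : forall u, sigma u -> forall n, C n (u n))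
    (sigma_analytic : analytic (sigma : set {ptws nat -> finest E}))
    (rho : nat -> E -> R) (hrho : forall n, Fnorm (rho n))
    (eps : R) (eps0 : 0 < eps) :
  exists2 V : set E, block_subspace e V &
    strategically_large e (enlargement e rho sigma eps) V.
Proof.
have [f [fc frange]] := sigma_analytic.
pose delta n : R := eps / 2 / (2 ^ n.+1)%:R.
have delta0 n : 0 < delta n / 2.
  by rewrite !divr_gt0 // ltr0n expn_gt0.
have /choice [net netP] (nb : nat * nat) : exists net : seq E, forall y,
    C nb.1 y -> deg e y nb.2 ->
    exists2 i, (i < size net)%N & rho nb.1 (y - nth 0 net i) < delta nb.1 / 2.
  have [F Ffin FP] := findim_deg nb.2.
  have [net netP] := compact_finite_net (hrho nb.1) (delta0 nb.1)
    (C_compact nb.1 F Ffin).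
  by exists net => y Cy yd; apply: netP; split=> //; exact: FP.
(* The entry of index [n] of a block basis has degree greater than [n], so only
   the nets of index [n < b] are needed in degree [b]. *)
pose width b := (\sum_(n < b) size (net (val n, b)))%N.
pose cell n (c : nat * nat) : set E := [set y |
  [/\ deg e y c.1, (c.2 < width c.1)%N &
      rho n (y - nth 0 (net (n, c.1)) c.2) < delta n / 2]].
pose branch s : set (nat -> E) := f @` [set mu | forall i, (i < size s)%N ->
  mu i = nth 0%N s i].
have branch_sigma s : branch s `<=` sigma.
  by move=> _ [mu _ <-]; rewrite -frange; exists mu.
have branch_block s : branch s `<=` block_basis e.
  by move=> v /branch_sigma; exact: sigma_block.
have branch_split s v : branch s v -> exists m, branch (rcons s m) v.
  move=> [mu mus <-]; exists (mu (size s)), mu => // i /=.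
  rewrite size_rcons ltnS nth_rcons leq_eqVlt => /predU1P[->|si].
    by rewrite ltnn eqxx.
  by rewrite si; exact: mus.
have cell_deg n c y : cell n c y -> deg e y c.1 by case.
have cell_width n c y : cell n c y -> (c.2 < width c.1)%N by case.
have branch_cell s v : branch s v -> forall n, exists c, cell n c (v n).
  move=> /branch_sigma sv n.
  have [N Nv] := (block_basisP he v).1 (sigma_block _ sv).
  have [_ vd] := Nv n; have nN := leq_ltn_trans (blocks_geq_id Nv n)
    (blocks_ltn Nv n).
  have [i iw vi] := netP (n, N n.+1) _ (sigma_sub_C v sv n) vd.
  exists (N n.+1, i); split=> //=; apply: leq_trans iw _.
  by rewrite /width (bigD1 (Ordinal nN)) //= leq_addr.
have [V [bV _ dV]] := decided_subspace he branch_block width cell_deg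
  (block_subspaceT he).
have V_large : large_from e branch cell V [::] [::].
  move=> W bW WV; have [v [sv [_ vW]]] := sigma_large W bW.
  exists v; split=> //; have: range f v by rewrite frange.
  by case=> mu _ <-; exists mu.
have winning p s : legit width (p, s) -> admissible e V p ->
    large_from e branch cell V p s -> reaches e branch cell V p s.
  exact: (large_reaches he branch_block branch_split cell_deg cell_width
    branch_cell).
pose inv (u : seq E) (st : state E) :=
  [/\ size u = size st.1.1, fin_blocks e u (height st.1.1),
      legit width st.1, admissible e V st.1.1 &
      wins e branch cell V st.2 st.1.1 st.1.2].
have legit0 : legit width ([::], [::]) by split.
have adm0 : admissible e V [::] by left.
have [t0 t0P] := winning _ _ legit0 adm0 V_large.
have Hstep u st W : inv u st -> block_subspace e W -> W `<=` V ->
    exists x st', [/\ W x, fin_block_basis e (rcons u x),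
      advances e branch cell V st x st' & inv (rcons u x) st'].
  case: st => -[p s] [|g] [/= up ub lps ap tw] bW WV; first by [].
  have [x [c [Wx xt xc H]]] := tw W bW WV.
  have ux : fin_blocks e (rcons u x) (height (rcons p c)).
    rewrite height_rcons.
    exact: (fin_blocks_rcons he ub xt (cell_deg _ _ _ xc)).
  have uxf : fin_block_basis e (rcons u x).
    by apply/fin_block_basisP; exists (height (rcons p c)).
  have lpc : legit width (rcons p c, s).
    exact: (legit_rcons cell_deg cell_width lps xt xc).
  have apc : admissible e V (rcons p c).
    right; exists x; first exact: WV.
    by rewrite height_rcons; exact: cell_deg xc.
  have usz : size (rcons u x) = size (rcons p c) by rewrite !size_rcons up.
  case: H => [[m mp Vm]|tw'].
    have lm : legit width (rcons p c, rcons s m).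
      apply: legit_reveal => //; rewrite size_rcons ltnS.
      by have [_ _ + _] := lps.
    have [t tP] := winning _ _ lm apc Vm.
    exists x, (rcons p c, rcons s m, t); split=> //.
    by exists c => //; left; exists m.
  exists x, (rcons p c, s, g W); split=> //.
  by exists c => //; right; split=> //; exists g, W.
have inv0 : inv [::] ([::], [::], t0).
  by split=> //=; exact: fin_blocks_nil.
have [Phi Phis PhiP] := strategy_of_machine he inv0 Hstep.
exists V => //; exists Phi => // W bW WV.
have [st st0 stS] := PhiP W bW WV.
have st01 : (st 0%N).1 = ([::], [::]) by rewrite st0.
have [ub [c [mu [uc limP]]]] := advances_limit he cell_deg bV V_large st01 stS.
set u := outcome Phi W in ub uc *.
have /choice [nu nuP] i : exists nu : nat -> nat,
    (forall k, (k < i)%N -> nu k = mu k) /\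
    forall j, (j < i)%N -> cell j (c j) (f nu j).
  have [_ [nu numu <-] nuc] := limP i; exists nu; split=> // k ki.
  by rewrite numu ?size_mkseq // nth_mkseq.
split=> //.
have umu j : rho j (u j - f mu j) <= delta j.
  apply/ler_addgt0Pr => eta eta0.
  have /(_ j _ eta0) [i0 _ i0P] := continuous_branch_approx (hrho j) fc
    (fun i k => (nuP i).1 k).
  pose i := maxn i0 j.+1.
  have ji : (j < i)%N by rewrite leq_max leqnn orbT.
  have i0i : (i0 <= i)%N by rewrite leq_max leqnn.
  have [_ _ ucj] := uc j; have [_ _ nucj] := (nuP i).2 j ji.
  have un := Fnorm_dist_lt (hrho j) ucj nucj.
  rewrite -splitr in un; have nm := i0P i i0i.
  rewrite -(subrK (f (nu i) j) (u j)) -addrA.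
  apply: le_trans (Fnorm_triangle (hrho j) _ _) _.
  by apply: lerD; exact: ltW.
apply: (@le_lt_trans _ _ (eps / 2)%:E); last first.
  by rewrite lte_fin ltr_pdivrMr // ltr_pMr // ltr1n.
have sd : (seq_dist rho u (f mu) <= (eps / 2)%:E)%E.
  apply: seq_dist_le => // [|j]; first by rewrite divr_gt0.
  exact: Fnorm_ge0.
apply: le_trans sd; apply: ereal_inf_lbound; exists (f mu) => //.
by rewrite -frange; exists mu.
Qed.

End Main.

Theorem theorem4p4 (R : realType) (k : scalar_kind)
    (E : lmodType (scalar_field R k)) (e : nat -> E) (he : hamel_basis e)
    (sigma : set (nat -> E)) (hsigma : sigma `<=` block_basis e)
    (sigma_large : large e sigma)
    (C : nat -> set E)
    (C_abs_convex : forall n, absolutely_convex (C n))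
    (C_compact : forall n (F : set E), findim_subspace F ->
       compact (C n `&` F : set (finest E)))
    (sigma_sub_C : forall u, sigma u -> forall n, C n (u n))
    (sigma_analytic : analytic (sigma : set {ptws nat -> finest E}))
    (rho : nat -> E -> R) (hrho : forall n, Fnorm (rho n))
    (eps : R) (heps : 0 < eps) :
  exists2 V : set E, block_subspace e V &
    strategically_large e (enlargement e rho sigma eps) V.
Proof.
exact: (enlargement_strategically_large he hsigma sigma_large C_compact
  sigma_sub_C sigma_analytic hrho heps).
Qed.
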